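(* Let $p\ge 1$ and $x>0$ be real, let $k\ge 2$ be an integer, and let $N=\lceil x^{1/2}\rceil$. Put $X_n=x/n^2$ for $n\ge 1$ (so that $X_N=x/N^2$). Then $$S_{2,p}(x)=\sum_{n=1}^{N-1}\frac{\mu(n)}{n^p}\bigl(1-e^{-X_n}\bigr)-\frac{1}{\zeta(p)}+T_N^{(1)}(p;x)+T_N^{(2)}(p;x),$$ where $$T_N^{(1)}(p;x)=\frac{1}{k!}\sum_{n=N}^\infty\frac{\mu(n)}{n^p}\,\frac{X_n^k\,\bigl(f_k(X_n)-g_k(X_n)\bigr)}{e_k(X_n)},$$ $$T_N^{(2)}(p;x)=\sum_{r=1}^{k-1}\frac{(-X_N)^r}{r!}\,\lambda_r,\qquad \lambda_r=N^{2r}\left\{\sum_{n=1}^{N-1}\frac{\mu(n)}{n^{2r+p}}-\frac{1}{\zeta(2r+p)}\right\}.$$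
   Context: Here $\zeta$ is the Riemann zeta function, with the convention $1/\zeta(1)=0$, and $\mu$ is the Möbius function. The generalised Riesz function with parameter $m=2$ is $$S_{2,p}(x)=\sum_{j=0}^\infty\frac{(-1)^{j-1}x^j}{j!\,\zeta(2j+p)}.$$ For integers $k\ge 0$, $f_k(z)=e^{-z}\,{}_1F_1(1;k+1;z)$, where ${}_1F_1(a;b;z)=\sum_{j\ge 0}\frac{(a)_j}{(b)_j}\frac{z^j}{j!}$ is the confluent hypergeometric function and $(a)_j=a(a+1)\cdots(a+j-1)$. For integers $k\ge1$, $e_k(z)=\sum_{r=0}^{k-1}\frac{z^r}{r!}$ is the sum of the first $k$ terms of the exponential series. For $k\ge 2$, $g_k$ is the polynomial of degree at most $k-2$ defined by $$\frac{1}{e_k(z)}=e_k(-z)+\frac{z^k g_k(z)}{k!\,e_k(z)},$$ i.e. $g_k(z)=k!\,\bigl(1-e_k(z)e_k(-z)\bigr)/z^k$. Empty sums are zero. *)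

(* Defs.v *)
From mathcomp Require Import all_boot all_order all_algebra.
From mathcomp Require Import all_classical all_reals all_analysis.
From mathcomp Require Import ring.

Set Implicit Arguments.
Unset Strict Implicit.
Unset Printing Implicit Defensive.

Import Order.TTheory GRing.Theory Num.Theory.
Import numFieldNormedType.Exports.

Local Open Scope classical_set_scope.
Local Open Scope ring_scope.

Definition moebius (n : nat) : int :=
  if (0 < n)%N && all (fun q => logn q n == 1)%N (primes n)
  then (-1) ^+ size (primes n) else 0.

(* Only real arguments s > 1 are relevant, where zeta is its Dirichlet series;
   the series diverges at s = 1 and [zeta 1] is then a meaningless default. *)
Definition zeta (R : realType) (s : R) : R := limn (series (riemannR s)).

(* 1 / zeta, with the convention 1 / zeta(1) = 0. *)
Definition inv_zeta (R : realType) (s : R) : R :=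
  if s == 1 then 0 else (zeta s)^-1.

(* The exponent j - 1 is an integer: the term j = 0 has sign (-1)^(-1) = -1. *)
Definition riesz2_term (R : realType) (p x : R) (j : nat) : R :=
  (-1) ^ (j%:Z - 1) * x ^+ j / j`!%:R * inv_zeta ((2 * j)%:R + p).

Definition riesz2 (R : realType) (p x : R) : R :=
  limn (series (riesz2_term p x)).

Definition pochhammer (R : realType) (a : R) (j : nat) : R :=
  \prod_(0 <= i < j) (a + i%:R).

Definition hyp1F1 (R : realType) (a b z : R) : R :=
  limn (series (fun j : nat =>
    pochhammer a j / pochhammer b j * (z ^+ j / j`!%:R))).

Definition f_ (R : realType) (k : nat) (z : R) : R :=
  expR (- z) * hyp1F1 1 k.+1%:R z.

Definition e_ (R : realType) (k : nat) : {poly R} :=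
  \poly_(r < k) (r`!%:R)^-1.

(* The division by 'X^k is exact for k >= 1: see [g_E] and [g_P]. *)
Definition g_ (R : realType) (k : nat) : {poly R} :=
  k`!%:R *: ((1 - e_ R k * (e_ R k \Po - 'X)) %/ 'X^k).

Lemma size_g_ (R : realType) (k : nat) : (1 < k)%N -> (size (g_ R k) <= k.-1)%N.
Proof.
move=> k1; rewrite (leq_trans (size_scale_leq _ _))// -Pdiv.IdomainMonic.drop_poly_divp.
rewrite size_drop_poly leq_subLR.
rewrite (leq_trans (size_polyD _ _))// size_polyN geq_max size_poly1.
apply/andP; split; first by rewrite addn_gt0 (ltnW k1).
rewrite (leq_trans (size_polyMleq _ _))//.
have se : (size (e_ R k) <= k)%N by exact: size_poly.
have sc : (size (e_ R k \Po - 'X)%R <= k)%N.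
  by rewrite size_comp_poly2 ?size_polyN ?size_polyX.
rewrite -[k in (_ <= k + _)%N](prednK (ltnW k1)) addSn -addnS prednK ?(ltnW k1)//.
rewrite -subn1 leq_subLR (leq_trans (leq_add se sc))//.
by rewrite addnA add1n prednK ?(ltnW k1).
Qed.

Lemma g_E (R : realType) (k : nat) : (0 < k)%N ->
  'X^k * g_ R k = k`!%:R *: (1 - e_ R k * (e_ R k \Po - 'X)).
Proof.
move=> k0; rewrite /g_ -scalerAr; congr (_ *: _).
set P := 1 - _.
have coefeN i : (e_ R k \Po - 'X)`_i = (-1) ^+ i * (e_ R k)`_i.
  rewrite comp_polyE; under eq_bigr => j _.
    rewrite -(mulN1r 'X) exprMn -signr_odd -(rmorphN1 (@polyC R)).
    rewrite -rmorphXn mul_polyC signr_odd scalerA; over.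
  rewrite coef_sum; under eq_bigr do rewrite coefZ coefXn.
  have [ik|ik] := ltnP i (size (e_ R k)).
    rewrite (bigD1 (Ordinal ik))//= eqxx mulr1 big1 ?addr0 1?mulrC//.
    move=> j /negPf ji; rewrite (_ : (i == j) = false) ?mulr0//.
    by apply/negbTE; rewrite eq_sym; apply/negPf; rewrite -ji.
  rewrite (nth_default _ ik) mulr0 big1// => j _.
  by rewrite gtn_eqF ?mulr0// (leq_trans (ltn_ord j)).
rewrite -Pdiv.IdomainMonic.drop_poly_divp mulrC -[RHS](poly_take_drop k).
suff -> : take_poly k P = 0 by rewrite add0r.
apply/polyP => i; rewrite coef_take_poly coef0; case: ifPn => // ik.
rewrite /P coefB coefM coef1.
under eq_bigr => j _.
  rewrite coefeN !coef_poly.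
  rewrite (leq_ltn_trans (leq_ord j) ik) (leq_ltn_trans (leq_subr j i) ik).
  over.
apply/eqP; rewrite subr_eq0; apply/eqP.
apply: (@mulfI _ (i`!%:R)); first by rewrite pnatr_eq0 -lt0n fact_gt0.
rewrite mulr_sumr (eq_bigr (fun j : 'I_i.+1 =>
    ((-1) ^+ (i - j) * 1 ^+ j) *+ 'C(i, j))); last first.
  move=> j _; rewrite -(bin_fact (leq_ord j)) expr1n mulr1 !natrM -mulr_natl.
  have : (j`!%:R : R) != 0 by rewrite pnatr_eq0 -lt0n fact_gt0.
  have : ((i - j)`!%:R : R) != 0 by rewrite pnatr_eq0 -lt0n fact_gt0.
  by move=> a b; field; rewrite a b.
rewrite -exprDn addNr expr0n; case: i ik => [|i] _ /=; first by rewrite mul1r.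
by rewrite mulr0.
Qed.

Lemma g_P (R : realType) (k : nat) (z : R) : (0 < k)%N -> (e_ R k).[z] != 0 ->
  1 / (e_ R k).[z] =
    (e_ R k).[- z] + z ^+ k * (g_ R k).[z] / (k`!%:R * (e_ R k).[z]).
Proof.
move=> k0 ez; have := congr1 (fun q : {poly R} => q.[z]) (g_E R k0).
rewrite !hornerE horner_comp !hornerE => ->.
have kf : (k`!%:R : R) != 0 by rewrite pnatr_eq0 -lt0n fact_gt0.
by field; rewrite ez kf.
Qed.

Definition X_ (R : realType) (x : R) (n : nat) : R := x / n%:R ^+ 2.

Definition T1_term (R : realType) (k : nat) (p x : R) (n : nat) : R :=
  (moebius n)%:~R / n%:R `^ p *
  (X_ x n ^+ k * (f_ k (X_ x n) - (g_ R k).[X_ x n]) / (e_ R k).[X_ x n]).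

Definition T1 (R : realType) (k N : nat) (p x : R) : R :=
  (k`!%:R)^-1 * limn (fun M => \sum_(N <= n < M) T1_term k p x n).

Definition lambda_ (R : realType) (N : nat) (p : R) (r : nat) : R :=
  N%:R ^+ (2 * r) *
  (\sum_(1 <= n < N) (moebius n)%:~R / n%:R `^ ((2 * r)%:R + p)
   - inv_zeta ((2 * r)%:R + p)).

Definition T2 (R : realType) (k N : nat) (p x : R) : R :=
  \sum_(1 <= r < k) (- X_ x N) ^+ r / r`!%:R * lambda_ N p r.

(* Main.v *)
Require Import Defs.
From mathcomp Require Import all_boot all_order all_algebra.
From mathcomp Require Import all_classical all_reals all_analysis.
From mathcomp Require Import ring lra.

Set Implicit Arguments.
Unset Strict Implicit.
Unset Printing Implicit Defensive.

Import Order.TTheory GRing.Theory Num.Theory.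
Import numFieldNormedType.Exports.

Local Open Scope classical_set_scope.
Local Open Scope ring_scope.

(* Put v_k(n) = mu(n) / n^p * (e_k(-X_n) - exp(-X_n)) and V_k = sum_n v_k(n),
   so that V_1 = sum_n mu(n) / n^p * (1 - exp(-X_n)).  Expanding e_k and using
   1 / zeta(s) = sum_n mu(n) / n^s for s = 2r + p > 1 shows that V_1 - V_k is
   the sum of the terms 1 <= j < k of the Riesz series.  Since V_k tends to 0,
   S_{2,p}(x) = V_1 - 1 / zeta(p); the value 1 / zeta(1) = 0 is never matched
   with a Dirichlet series, so the prime number theorem is not involved.  The
   n-th term of T_N^(1) is k! v_k(n), hence T_N^(1) = V_k - sum_(n < N) v_k(n),
   and T_N^(2) gathers the rest. *)

(** * The Möbius function and its divisor sum *)

Lemma moebius0 : moebius 0 = 0.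
Proof. by []. Qed.

Lemma normr_moebius_le1 n : `|moebius n| <= 1.
Proof.
by rewrite /moebius; case: ifP => _; rewrite ?normr0// normrX normrN1 expr1n.
Qed.

Lemma perm_primesMl p d : prime p -> (0 < d)%N -> ~~ (p %| d)%N ->
  perm_eq (primes (p * d)) (p :: primes d).
Proof.
move=> p_pr d0 pd; apply: uniq_perm; first exact: primes_uniq.
  by rewrite /= primes_uniq mem_primes (negPf pd) !andbF.
by move=> q; rewrite primesM ?(prime_gt0 p_pr)// (primes_prime p_pr) !inE.
Qed.

(** A prime not dividing [d] lengthens the list of primes by one and leaves the other multiplicities
    alone, so squarefreeness is unaffected and only the sign flips. *)
Lemma moebiusMprime p d : prime p -> ~~ (p %| d)%N ->
  moebius (p * d) = - moebius d.
Proof.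
move=> p_pr pd; have d0 : (0 < d)%N by case: d pd => //; rewrite dvdn0.
have p0 := prime_gt0 p_pr.
have pe := perm_primesMl p_pr d0 pd.
rewrite /moebius muln_gt0 p0 d0 /= (perm_all _ pe) (perm_size pe) /=.
rewrite lognM// (logn_prime p p_pr) eqxx logn_coprime ?prime_coprime//=.
have -> : all (fun q => logn q (p * d) == 1)%N (primes d)
    = all (fun q => logn q d == 1)%N (primes d).
  apply: eq_in_all => q; rewrite mem_primes => /and3P[q_pr _ qd].
  rewrite lognM// (logn_prime q p_pr) (_ : (q == p) = false)//.
  by apply/eqP => qp; rewrite -qp qd in pd.
by case: ifP => _; rewrite ?oppr0// exprS mulN1r.
Qed.

Lemma moebiusMprime0 p d : prime p -> (p %| d)%N -> moebius (p * d) = 0.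
Proof.
move=> p_pr pd; case: (posnP d) => [->|d0]; first by rewrite muln0.
have p0 := prime_gt0 p_pr.
rewrite /moebius ifF//; apply/negbTE; rewrite negb_and muln_gt0 p0 d0 /=.
apply/allPn; exists p; first by rewrite mem_primes p_pr muln_gt0 p0 d0 dvdn_mulr.
rewrite lognM// (logn_prime p p_pr) eqxx.
have : (0 < logn p d)%N by rewrite logn_gt0 mem_primes p_pr d0.
by case: (logn p d).
Qed.

(* The squarefree divisors of n are paired as d <-> p * d, where p is a fixed
   prime factor of n and d is prime to p. *)
Lemma sum_moebius_divisors n : (0 < n)%N ->
  \sum_(d <- divisors n) moebius d = (n == 1)%:R.
Proof.
move=> n0; have [->|n1] := eqVneq n 1%N.
  by rewrite (_ : divisors 1 = [:: 1%N])// big_seq1.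
have {}n1 : (1 < n)%N by case: n n0 n1 => [|[]].
set p := pdiv n; have p_pr : prime p by exact: pdiv_prime.
have p0 := prime_gt0 p_pr.
rewrite (bigID (fun d => p %| d)%N) /=.
(* Among the divisors divisible by [p], this second split isolates those divisible by [p^2], which
   contribute 0. *)
rewrite (bigID (fun d => p %| d %/ p)%N) /= big1 ?add0r; last first.
  by move=> _ /andP[/dvdnP[e ->]]; rewrite mulnK// mulnC => /moebiusMprime0 ->.
rewrite -big_filter -[X in _ + X]big_filter.
set A := seq.filter _ _; set B := seq.filter _ _.
rewrite (perm_big (map (muln p) B)) /=; last first.
  apply: uniq_perm; rewrite ?filter_uniq ?divisors_uniq//.
    rewrite map_inj_uniq ?filter_uniq ?divisors_uniq//.
    by move=> i j /eqP; rewrite eqn_pmul2l// => /eqP.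
  move=> d; rewrite mem_filter -dvdn_divisors//; apply/idP/mapP.
    move=> /andP[/andP[/dvdnP[e ->]]]; rewrite mulnK// mulnC => pe pen.
    exists e => //.
    by rewrite mem_filter -dvdn_divisors// pe (dvdn_trans _ pen)// dvdn_mull.
  move=> [e]; rewrite mem_filter -dvdn_divisors// => /andP[pe en] ->.
  rewrite dvdn_mulr//= mulKn// pe Gauss_dvd ?prime_coprime//.
  by rewrite pdiv_dvd en.
rewrite big_map big_seq [X in _ + X]big_seq -big_split big1//= => d.
rewrite mem_filter => /andP[pd _].
by rewrite moebiusMprime// addNr.
Qed.

(** * The powers n^(-s) and the zeta series for s >= 2 *)

Definition npowN (R : realType) (s : R) (n : nat) : R := (n%:R `^ s)^-1.

Lemma npowN_ge0 (R : realType) (s : R) n : 0 <= npowN s n.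
Proof. by rewrite invr_ge0 powR_ge0. Qed.

Lemma npowN0 (R : realType) (s : R) : s != 0 -> npowN s 0 = 0.
Proof. by move=> s0; rewrite /npowN powR0// invr0. Qed.

Lemma npowN1 (R : realType) (s : R) : npowN s 1 = 1.
Proof. by rewrite /npowN powR1 invr1. Qed.

Lemma npowNM (R : realType) (s : R) m n :
  npowN s (m * n) = npowN s m * npowN s n.
Proof. by rewrite /npowN natrM powRM// invfM. Qed.

Lemma npowND (R : realType) (s t : R) n : (0 < n)%N ->
  npowN (s + t) n = npowN s n * npowN t n.
Proof. by move=> n0; rewrite /npowN powRD ?invfM// pnatr_eq0 -lt0n n0 implybT. Qed.

Lemma npowN_nat (R : realType) (r n : nat) : npowN (r%:R : R) n = n%:R ^- r.
Proof. by rewrite /npowN powR_mulrn. Qed.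

Lemma npowN_le (R : realType) (s t : R) n : (0 < n)%N -> s <= t ->
  npowN t n <= npowN s n.
Proof.
move=> n0 st; rewrite lef_pV2 ?posrE ?powR_gt0 ?ltr0n//.
by rewrite ler_powR// ler1n.
Qed.

(** [riemannR s] begins with 1^(-s), while [npowN s] has the default value 0 at index 0; hence the
    shift by one. *)
Lemma series_npowN (R : realType) (s : R) n : s != 0 ->
  series (npowN s) n.+1 = series (riemannR s) n.
Proof.
by move=> s0; rewrite seriesEnat /= big_nat_recl// npowN0// add0r.
Qed.

(* Telescoping bound: 1 / n^2 <= 1 / (n - 1) - 1 / n. *)
Lemma is_cvg_series_npowN (R : realType) (s : R) : 2 <= s ->
  cvgn (series (npowN s)).
Proof.
move=> s2; apply: nondecreasing_is_cvgn.
  by apply/nondecreasing_seqP => n; rewrite seriesSr lerDl npowN_ge0.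
exists 2 => _ [n _ <-].
(* The term at 1 contributes 1, and the telescoped terms at 2, ..., m + 1 contribute at most 1 - 1 /
   (m + 1). *)
suff H m : series (npowN s) m.+2 <= 2 - m.+1%:R^-1.
  case: n => [|[|n]].
  - by rewrite seriesEnat /= big_geq.
  - by rewrite seriesSr seriesEnat /= big_geq// add0r npowN0//; lra.
  - by rewrite (le_trans (H n))// gerBl.
elim: m => [|m IH].
  rewrite seriesEnat /= big_nat_recr//= big_nat1 npowN0 ?npowN1 ?invr1; last first.
    by apply/eqP; lra.
  lra.
rewrite seriesSr; apply: (le_trans (lerD IH (@npowN_le _ _ _ m.+2 isT s2))).
rewrite (npowN_nat R 2) -(natr1 m.+1).
set y : R := m.+1%:R; have y0 : 0 < y by rewrite ltr0n.
rewrite -subr_ge0.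
have -> : 2 - (y + 1)^-1 - (2 - y^-1 + (y + 1) ^- 2) = y^-1 * (y + 1) ^- 2.
  by field; lra.
by rewrite mulr_ge0// invr_ge0 ?exprn_ge0 ?ltW//; lra.
Qed.

Lemma cvg_zeta (R : realType) (s : R) : 2 <= s ->
  series (npowN s) n @[n --> \oo] --> zeta s.
Proof.
move=> s2; have s0 : s != 0 by apply/eqP; lra.
suff -> : zeta s = limn (series (npowN s)) by exact: is_cvg_series_npowN.
apply: cvg_lim => //.
have -> : series (riemannR s) = (fun n => series (npowN s) (n + 1)%N).
  by apply/funext => n; rewrite addn1 series_npowN.
by rewrite cvg_shiftn; exact: is_cvg_series_npowN.
Qed.

(** The partial sums are nondecreasing and the one ending at n = 1 already equals 1, so zeta is at
    least 1. *)
Lemma zeta_neq0 (R : realType) (s : R) : 2 <= s -> zeta s != 0.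
Proof.
move=> s2; have s0 : s != 0 by apply/eqP; lra.
apply: lt0r_neq0; apply: (@lt_le_trans _ _ 1) => //.
rewrite -(cvg_lim _ (cvg_zeta s2))//.
apply: le_trans (nondecreasing_cvgn_le _ (is_cvg_series_npowN s2) 2).
  by rewrite seriesEnat /= big_nat_recr//= big_nat1 npowN0// npowN1 add0r.
by apply/nondecreasing_seqP => n; rewrite seriesSr lerDl npowN_ge0.
Qed.

(** * The Dirichlet series of 1 / zeta *)

Lemma sum_moebius_dvdn (R : realType) n M : (0 < n <= M)%N ->
  \sum_(1 <= d < M.+1) \sum_(1 <= m < M.+1 | n == (d * m)%N) (moebius d)%:~R
  = (n == 1%N)%:R :> R.
Proof.
move=> /andP[n0 nM].
transitivity (\sum_(1 <= d < M.+1 | (d %| n)%N) (moebius d)%:~R : R).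
  (* For fixed [d] the only possible [m] is the cofactor of [d] in [n], which is in range because
     [n <= M]. *)
  rewrite [RHS]big_mkcond; apply: eq_big_nat => d /andP[d0 dM].
  case: ifPn => [/dvdnP[e ne]|dn].
    rewrite -big_filter (_ : [seq _ <- _ | _] = [:: e]) ?big_seq1//.
    have e0 : (0 < e)%N by move: n0; rewrite ne muln_gt0 => /andP[].
    apply/perm_small_eq => //; apply: uniq_perm => //.
      by rewrite filter_uniq ?iota_uniq.
    move=> m; rewrite mem_filter mem_index_iota inE ne mulnC eqn_pmul2l// eq_sym.
    case: eqP => //= ->; rewrite e0 ltnS (leq_trans _ nM)// ne.
    by rewrite leq_pmulr.
  rewrite big1// => m /eqP nE; move: dn; rewrite nE dvdn_mulr//.
rewrite -big_filter (perm_big (divisors n)) /=.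
  by rewrite -rmorph_sum /= sum_moebius_divisors//; case: eqP.
apply: uniq_perm; rewrite ?filter_uniq ?iota_uniq ?divisors_uniq// => d.
rewrite mem_filter mem_index_iota -dvdn_divisors//.
case: (boolP (d %| n)%N) => //= dn.
by rewrite (dvdn_gt0 n0 dn) ltnS (leq_trans _ nM)// dvdn_leq.
Qed.

(** Grouping the pairs by the product n = d * m, the coefficient of n^(-s) is the divisor sum of mu,
    so only n = 1 survives. This is a finite form of zeta(s) * sum mu(n) / n^s = 1. *)
Lemma sum_moebius_hyperbola (R : realType) (s : R) M : (0 < M)%N ->
  \sum_(1 <= d < M.+1) \sum_(1 <= m < M.+1 | (d * m <= M)%N)
    (moebius d)%:~R * (npowN s d * npowN s m) = 1.
Proof.
move=> M0.
transitivity (\sum_(1 <= n < M.+1) npowN s n * \sum_(1 <= d < M.+1)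
    \sum_(1 <= m < M.+1 | n == (d * m)%N) (moebius d)%:~R).
  under [RHS]eq_bigr do rewrite mulr_sumr.
  rewrite exchange_big /=; apply: eq_big_nat => d /andP[d0 _].
  under [RHS]eq_bigr do rewrite mulr_sumr big_mkcond.
  rewrite exchange_big /= big_mkcond; apply: eq_big_nat => m /andP[m0 _].
  rewrite -big_mkcond; case: ifPn => dmM.
    rewrite -big_filter (_ : [seq _ <- _ | _] = [:: (d * m)%N]).
      by rewrite big_seq1 npowNM mulrC.
    apply/perm_small_eq => //; apply: uniq_perm => //.
      by rewrite filter_uniq ?iota_uniq.
    move=> n; rewrite mem_filter mem_index_iota inE.
    by case: eqP => //= ->; rewrite muln_gt0 d0 m0 ltnS dmM.
  rewrite big_nat_cond big1// => n /andP[/andP[_ nM] /eqP nE].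
  by move: dmM; rewrite -nE -ltnS nM.
rewrite big_nat (eq_bigr (fun n => npowN s n * (n == 1%N)%:R)); last first.
  by move=> n nM; rewrite sum_moebius_dvdn.
rewrite -big_nat big_ltn// eqxx mulr1 npowN1 big_nat big1 ?addr0// => n.
by case: n => [|[|n]]// _; rewrite mulr0.
Qed.

Definition moebius_term (R : realType) (s : R) (n : nat) : R :=
  (moebius n)%:~R * npowN s n.

Lemma moebius_term0 (R : realType) (s : R) : moebius_term s 0 = 0.
Proof. by rewrite /moebius_term moebius0 mul0r. Qed.

Lemma normr_moebius_term_le (R : realType) (s : R) n :
  `|moebius_term s n| <= npowN s n.
Proof.
rewrite normrM (ger0_norm (npowN_ge0 _ _)) ler_piMl ?npowN_ge0//.
by rewrite -intr_norm -[1]/(1%:~R) ler_int normr_moebius_le1.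
Qed.

Lemma is_cvg_series_le_norm (R : realType) (u v : R^nat) :
  (forall n, `|u n| <= v n) -> cvgn (series v) -> cvgn (series u).
Proof.
move=> uv cv; apply: normed_cvg; apply: series_le_cvg cv => //= n.
exact: le_trans (normr_ge0 _) (uv n).
Qed.

Lemma lim_series_le_norm (R : realType) (u v : R^nat) :
  (forall n, `|u n| <= v n) -> cvgn (series v) ->
  `|limn (series u)| <= limn (series v).
Proof.
move=> uv cv; have cu : cvgn [normed series u].
  by apply: series_le_cvg cv => //= n; exact: le_trans (normr_ge0 _) (uv n).
by rewrite (le_trans (lim_series_norm cu))// lim_series_le.
Qed.

Lemma series_from1 (V : zmodType) (u : V^nat) n : u 0 = 0 ->
  series u n.+1 = \sum_(1 <= i < n.+1) u i.
Proof. by move=> u0; rewrite seriesEnat /= big_ltn// u0 add0r. Qed.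

(* With M = L^2, the pairs (d, m) omitted by the hyperbola d * m <= M have
   d > L or m > L, so they contribute at most Z(M)^2 - Z(L)^2, where Z is the
   partial sum of zeta. *)
Lemma cvg_series_moebius_term (R : realType) (s : R) : 2 <= s ->
  series (moebius_term s) n @[n --> \oo] --> (zeta s)^-1.
Proof.
move=> s2; have s0 : s != 0 by apply/eqP; lra.
have cZ := cvg_zeta s2.
have cA : cvgn (series (moebius_term s)).
  exact: is_cvg_series_le_norm (normr_moebius_term_le s) (is_cvg_series_npowN s2).
set A := series (moebius_term s) in cA *; set Z := series (npowN s) in cZ.
have sq_oo : (L * L).+1 @[L --> \oo] --> \oo.
  apply/cvgnyPge => B; near=> L; have : (B <= L)%N by near: L; exact: nbhs_infty_ge.
  move=> BL; rewrite (leq_trans BL)// ltnW// ltnS.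
  by case: (L) => // L'; rewrite leq_pmulr.
have S_oo : L.+1 @[L --> \oo] --> \oo.
  by apply/cvgnyPge => B; near=> L; apply: leqW; near: L; exact: nbhs_infty_ge.
have bound L : (0 < L)%N ->
    `|A (L * L).+1 * Z (L * L).+1 - 1| <= Z (L * L).+1 ^+ 2 - Z L.+1 ^+ 2.
  move=> L0; set M := (L * L)%N; have M0 : (0 < M)%N by rewrite muln_gt0 L0.
  have LM : (L <= M)%N by rewrite leq_pmulr.
  rewrite -(sum_moebius_hyperbola s M0) /A /Z.
  rewrite !series_from1 ?moebius_term0 ?npowN0//.
  rewrite !expr2 !mulr_suml.
  under eq_bigr do rewrite mulr_sumr; rewrite -sumrB.
  (* Since L <= M, Z(L)^2 is written over the same index square as Z(M)^2, with the pairs cut down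
     to d, m <= L; the two sides can then be compared pair by pair. *)
  rewrite [X in _ <= _ - X](_ : _ = \sum_(1 <= d < M.+1)
      \sum_(1 <= m < M.+1 | (d <= L)%N && (m <= L)%N) npowN s d * npowN s m).
    rewrite -sumrB (le_trans (ler_norm_sum _ _ _))// ler_sum// => d _.
    rewrite mulr_sumr; rewrite [X in _ - X]big_mkcond [X in _ <= _ - X]big_mkcond /=.
    rewrite -!sumrB (le_trans (ler_norm_sum _ _ _))// ler_sum// => m _.
    have p0 : 0 <= npowN s d * npowN s m by rewrite mulr_ge0 ?npowN_ge0.
    rewrite /moebius_term -mulrA; case: (leqP (d * m) M) => dmM.
      rewrite subrr normr0; case: ifP => _; rewrite ?subrr// subr0//.
    rewrite ifF; last first.
      apply/negbTE/negP => /andP[dL mL]; move: dmM.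
      by rewrite ltnNge leq_mul.
    rewrite !subr0 normrM (ger0_norm p0) ler_piMl//.
    by rewrite -intr_norm -[1]/(1%:~R) ler_int normr_moebius_le1.
  rewrite [RHS](big_cat_nat _ (n := L.+1)) //= [X in _ = _ + X]big_nat.
  rewrite [X in _ = _ + X]big1 ?addr0; last first.
    by move=> d /andP[Ld _]; rewrite big1// leqNgt Ld.
  apply: eq_big_nat => d /andP[_ dL]; rewrite mulr_sumr -ltnS dL /=.
  rewrite [RHS](big_cat_nat _ (n := L.+1)) //= [X in _ = _ + X]big_nat_cond.
  rewrite [X in _ = _ + X]big1 ?addr0; last first.
    by move=> m /andP[/andP[Lm _]]; rewrite leqNgt Lm.
  by rewrite [RHS]big_nat_cond [LHS]big_nat; apply: eq_bigl => m;
    rewrite ltnS -andbA andbb.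
(* [A] is already known to converge, so its limit can be determined along the subsequence
   [(L * L).+1]. *)
have c1 : A (L * L).+1 * Z (L * L).+1 - 1 @[L --> \oo] --> limn A * zeta s - 1.
  apply: cvgB; last exact: cvg_cst.
  by apply: cvgM; apply: (cvg_comp _ _ sq_oo).
have c2 : Z (L * L).+1 ^+ 2 - Z L.+1 ^+ 2 @[L --> \oo] --> zeta s ^+ 2 - zeta s ^+ 2.
  have c (f : nat -> nat) : f L @[L --> \oo] --> \oo ->
      Z (f L) ^+ 2 @[L --> \oo] --> zeta s ^+ 2.
    by move=> foo; rewrite !expr2; apply: cvgM; apply: (cvg_comp _ _ foo).
  by apply: cvgB; exact: c.
rewrite subrr in c2.
have c3 : A (L * L).+1 * Z (L * L).+1 - 1 @[L --> \oo] --> (0 : R).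
  apply: norm_cvg0; apply: (squeeze_cvgr _ (cvg_cst 0) c2).
  near=> L; rewrite normr_ge0 bound//; near: L; exact: nbhs_infty_gt.
have AZ : limn A * zeta s = 1.
  by apply/eqP; rewrite -subr_eq0; apply/eqP; exact: cvg_unique c1 c3.
suff <- : limn A = (zeta s)^-1 by [].
by rewrite -[LHS](mulfK (zeta_neq0 s2)) AZ mul1r.
Unshelve. all: by end_near.
Qed.

(** * Tails of the exponential series and the function f_k *)

Lemma fact_neq0 (R : realType) n : n`!%:R != 0 :> R.
Proof. by rewrite pnatr_eq0 -lt0n fact_gt0. Qed.

Lemma horner_e_ (R : realType) k (z : R) :
  (e_ R k).[z] = series (exp_coeff z) k.
Proof.
rewrite horner_poly seriesEord /=; apply: eq_bigr => i _.
by rewrite /exp_coeff /= mulrC.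
Qed.

Lemma series_exp_tail (R : realType) k (z : R) n :
  series (exp_coeff z) (n + k)%N - (e_ R k).[z] =
  \sum_(0 <= i < n) exp_coeff z (i + k)%N.
Proof.
rewrite horner_e_ series_addn addrAC subrr add0r.
by rewrite -{1}(add0n k) big_addn addnK.
Qed.

Lemma cvg_series_exp_tail (R : realType) k (z : R) :
  series (exp_coeff z) (n + k)%N - (e_ R k).[z] @[n --> \oo]
    --> expR z - (e_ R k).[z].
Proof.
apply: cvgB; last exact: cvg_cst.
rewrite cvg_shiftn; exact: is_cvg_series_exp_coeff.
Qed.

(** As (i + k)! >= i! * k!, the tail is dominated term by term by |z|^k / k! times the series of exp
    |z|. *)
Lemma expR_taylor_le (R : realType) k (z : R) :
  `|expR z - (e_ R k).[z]| <= `|z| ^+ k / k`!%:R * expR `|z|.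
Proof.
have c : `|series (exp_coeff z) (n + k)%N - (e_ R k).[z]| @[n --> \oo]
    --> `|expR z - (e_ R k).[z]|.
  by apply: cvg_norm; exact: cvg_series_exp_tail.
rewrite -(cvg_lim _ c)//; apply: limr_le; first by apply/cvg_ex; eexists; exact: c.
near=> n; rewrite series_exp_tail (le_trans (ler_norm_sum _ _ _))//.
apply: (@le_trans _ _ (`|z| ^+ k / k`!%:R * series (exp_coeff `|z|) n)).
  rewrite seriesEnat /= mulr_sumr ler_sum// => i _; rewrite /exp_coeff /=.
  rewrite normrM normrX normfV normr_nat exprD [leRHS]mulrACA.
  rewrite [X in _ <= X * _]mulrC ler_wpM2l ?mulr_ge0 ?exprn_ge0//.
  rewrite -invfM lef_pV2 ?posrE ?mulr_gt0 ?ltr0n ?fact_gt0// -natrM ler_nat.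
  by rewrite -(bin_fact (leq_addl i k)) addnK mulnC leq_pmull// bin_gt0 leq_addl.
rewrite ler_wpM2l ?divr_ge0 ?exprn_ge0//.
apply: nondecreasing_cvgn_le; last exact: is_cvg_series_exp_coeff.
by apply/nondecreasing_seqP => m; rewrite seriesSr lerDl exp_coeff_ge0.
Unshelve. all: by end_near. Qed.

Lemma pochhammer1 (R : realType) j : pochhammer 1 j = j`!%:R :> R.
Proof.
rewrite /pochhammer fact_prod natr_prod big_add1 /=.
by apply: eq_bigr => i _; rewrite nat1r.
Qed.

Lemma pochhammerS (R : realType) k j :
  k`!%:R * pochhammer k.+1%:R j = (k + j)`!%:R :> R.
Proof.
elim: j => [|j IH]; first by rewrite /pochhammer big_geq// mulr1 addn0.
rewrite /pochhammer big_nat_recr//= -/(pochhammer _ _) mulrA IH.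
by rewrite addnS factS natrM mulrC -natrD addSn.
Qed.

(** In the hypergeometric series (1)_j cancels j!, and k! * (k + 1)_j = (k + j)!; what remains, up
    to the factor k! / z^k, is the exponential series from index k on. *)
Lemma hyp1F1_1S (R : realType) k (z : R) : z != 0 ->
  z ^+ k * hyp1F1 1 k.+1%:R z = k`!%:R * (expR z - (e_ R k).[z]).
Proof.
move=> z0; have zk0 : z ^+ k != 0 by rewrite expf_neq0.
suff -> : hyp1F1 1 k.+1%:R z = k`!%:R / z ^+ k * (expR z - (e_ R k).[z]).
  by rewrite mulrA mulrCA divff// mulr1.
apply: cvg_lim => //.
rewrite (_ : series _ = fun n => k`!%:R / z ^+ k
    * (series (exp_coeff z) (n + k)%N - (e_ R k).[z])); last first.
  apply/funext => n; rewrite series_exp_tail seriesEnat /= mulr_sumr.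
  apply: eq_bigr => j _; rewrite pochhammer1 addnC.
  rewrite [exp_coeff _ _](_ : _ = z ^+ (k + j) / (k + j)`!%:R)// -pochhammerS.
  have pk0 : pochhammer k.+1%:R j != 0 :> R.
    by apply: contra_neq (fact_neq0 R (k + j)) => h; rewrite -pochhammerS h mulr0.
  by rewrite exprD; field; rewrite zk0 pk0 !fact_neq0.
by apply: cvgMr; exact: cvg_series_exp_tail.
Qed.

Lemma e_gt0 (R : realType) k (z : R) : (0 < k)%N -> 0 <= z -> 0 < (e_ R k).[z].
Proof.
case: k => // k _ z0; rewrite horner_e_ seriesEnat /= big_nat_recl//.
rewrite {1}/exp_coeff /= expr0 fact0 divr1 ltr_pwDl// sumr_ge0// => i _.
exact: exp_coeff_ge0.
Qed.

(* f_k and g_k are the normalised remainders of 1 / e_k(z) against exp(-z) and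
   e_k(-z) respectively. *)
Lemma f_sub_gE (R : realType) k (z : R) : (0 < k)%N -> 0 < z ->
  z ^+ k * (f_ k z - (g_ R k).[z]) / (e_ R k).[z]
  = k`!%:R * ((e_ R k).[- z] - expR (- z)).
Proof.
move=> k0 z0; have ez : (e_ R k).[z] != 0 by rewrite gt_eqF ?e_gt0// ltW.
have gz : z ^+ k * (g_ R k).[z] = k`!%:R * (1 - (e_ R k).[z] * (e_ R k).[- z]).
  have := congr1 (fun q : {poly R} => q.[z]) (g_E R k0).
  by rewrite !hornerE horner_comp !hornerE.
(* The numerators are k! * (1 - e_k(z) exp(-z)) and k! * (1 - e_k(z) e_k(-z)); in their difference
   the 1s cancel and e_k(z) divides out. *)
rewrite mulrBr gz /f_ mulrCA hyp1F1_1S ?gt_eqF//.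
have eV : expR (- z) * expR z = 1 by rewrite -expRD addNr expR0.
rewrite mulrCA [expR (- z) * _]mulrBr eV; by field.
Qed.

(** * Möbius-weighted remainders and the sum of the Riesz series *)

Lemma riesz2_termE (R : realType) (p x : R) j :
  riesz2_term p x j = - ((- x) ^+ j / j`!%:R * inv_zeta ((2 * j)%:R + p)).
Proof.
rewrite /riesz2_term.
have -> : (-1) ^ (j%:Z - 1) = - (-1) ^+ j :> R.
  by rewrite expfzDr ?oppr_eq0 ?oner_eq0// exprN1 invrN1 mulrN1.
by rewrite !mulNr -exprMn mulN1r.
Qed.

Lemma npowN_le1 (R : realType) (s : R) n : (0 < n)%N -> 0 <= s ->
  npowN s n <= 1.
Proof.
by move=> n0 /(npowN_le n0) /le_trans -> //; rewrite /npowN powRr0 invr1.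
Qed.

(** This is v_k(n); its series has sum V_k. *)
Definition remainder_term (R : realType) (p x : R) k n : R :=
  moebius_term p n * ((e_ R k).[- X_ x n] - expR (- X_ x n)).

Lemma remainder_term0 (R : realType) (p x : R) k : remainder_term p x k 0 = 0.
Proof. by rewrite /remainder_term moebius_term0 mul0r. Qed.

(** The Taylor bound is X_n^k / k! * exp(X_n), where X_n <= x and, as k >= 1, X_n^k <= x^k / n^2.
    The bound separates [k] from [n]: it is summable in [n], and its coefficient tends to 0 with
    [k]. *)
Lemma normr_remainder_term_le (R : realType) (p x : R) k n :
  0 <= p -> 0 <= x -> (0 < k)%N ->
  `|remainder_term p x k n| <= x ^+ k / k`!%:R * expR x * npowN 2 n.
Proof.
move=> p0 x0 k0; case: n => [|n].
  by rewrite remainder_term0 normr0 !mulr_ge0 ?npowN_ge0 ?expR_ge0 ?exprn_ge0.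
set X := X_ x n.+1; have X0 : 0 <= X by rewrite divr_ge0 ?exprn_ge0.
have n2 : npowN 2 n.+1 <= 1 :> R.
  exact: npowN_le1.
rewrite normrM distrC.
have := expR_taylor_le k (- X); rewrite normrN (ger0_norm X0) => tl.
have m1 : `|moebius_term p n.+1| <= 1.
  by rewrite (le_trans (normr_moebius_term_le _ _))// npowN_le1.
apply: (le_trans (ler_pM (normr_ge0 _) (normr_ge0 _) m1 tl)); rewrite mul1r.
have XE : X = x * npowN 2 n.+1 by rewrite /X /X_ (npowN_nat R 2).
have Xx : X <= x by rewrite XE ler_piMr.
rewrite [leRHS]mulrAC ler_pM ?divr_ge0 ?exprn_ge0 ?expR_ge0 ?ler_expR//.
rewrite [leRHS]mulrAC ler_wpM2r// XE exprMn ler_wpM2l ?exprn_ge0//.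
by rewrite -[leRHS]expr1 ler_wiXn2l// npowN_ge0.
Qed.

Lemma moebius_termD (R : realType) (p x : R) r n :
  moebius_term p n * (- X_ x n) ^+ r
  = (- x) ^+ r * moebius_term ((2 * r)%:R + p) n.
Proof.
case: n => [|n]; first by rewrite /moebius_term moebius0 !mul0r mulr0.
rewrite /moebius_term npowND// npowN_nat /X_ -mulNr exprMn exprVn -exprM.
set y := _ ^- _; set m := _%:~R; set q := npowN _ _.
by ring.
Qed.

Lemma horner_e_from1 (R : realType) (z : R) k : (0 < k)%N ->
  (e_ R k).[z] = 1 + \sum_(1 <= r < k) z ^+ r / r`!%:R.
Proof.
move=> k0; rewrite horner_e_ seriesEnat /= big_ltn//; congr (_ + _).
by rewrite /exp_coeff /= expr0 fact0 divr1.
Qed.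

(** The exponentials and the constant Taylor terms cancel. In degree r, the factor X_n^r = x^r /
    n^(2r) raises the Dirichlet exponent from p to 2r + p. *)
Lemma remainder_termB (R : realType) (p x : R) k n : (0 < k)%N ->
  remainder_term p x k n - remainder_term p x 1 n
  = \sum_(1 <= r < k) (- x) ^+ r / r`!%:R * moebius_term ((2 * r)%:R + p) n.
Proof.
move=> k0; rewrite /remainder_term -mulrBr !horner_e_from1//.
rewrite [X in _ - (1 + X - _)]big_geq// addr0.
set E := \sum_(_ <= _ < _) _; transitivity (moebius_term p n * E); first by ring.
rewrite mulr_sumr; apply: eq_bigr => r _.
by rewrite mulrA moebius_termD mulrAC.
Qed.

Lemma series_remainder_termB (R : realType) (p x : R) k M : (0 < k)%N ->
  series (remainder_term p x k) M - series (remainder_term p x 1) M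
  = \sum_(1 <= r < k)
      (- x) ^+ r / r`!%:R * series (moebius_term ((2 * r)%:R + p)) M.
Proof.
move=> k0; rewrite !seriesEnat /= -sumrB.
under [RHS]eq_bigr do rewrite seriesEnat /= mulr_sumr.
by rewrite exchange_big; apply: eq_bigr => n _; rewrite remainder_termB.
Qed.

Lemma cvg_series_remainder_term (R : realType) (p x : R) k :
  0 <= p -> 0 <= x -> (0 < k)%N -> cvgn (series (remainder_term p x k)).
Proof.
move=> p0 x0 k0.
apply: (is_cvg_series_le_norm (fun n => normr_remainder_term_le n p0 x0 k0)).
by apply: is_cvg_seriesZ; exact: is_cvg_series_npowN.
Qed.

Lemma cvg_lim_series_remainder_term (R : realType) (p x : R) :
  0 <= p -> 0 <= x ->
  limn (series (remainder_term p x k)) @[k --> \oo] --> (0 : R).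
Proof.
move=> p0 x0.
have c2 := @is_cvg_series_npowN R 2 (lexx _).
have H k : (0 < k)%N -> `|limn (series (remainder_term p x k))| <=
    exp_coeff x k * (expR x * limn (series (npowN (2 : R)))).
  move=> k0; have le n : `|remainder_term p x k n|
      <= ((x ^+ k / k`!%:R * expR x) *: npowN (2 : R)) n.
    exact: normr_remainder_term_le.
  apply: (le_trans (lim_series_le_norm le (is_cvg_seriesZ c2))).
  by rewrite lim_seriesZ// mulrA.
have c : exp_coeff x k * (expR x * limn (series (npowN (2 : R)))) @[k --> \oo]
    --> (0 : R).
  rewrite -[X in _ --> X](mul0r (expR x * limn (series (npowN (2 : R))))).
  by apply: cvgMl; exact: cvg_exp_coeff.
apply: norm_cvg0; apply: (squeeze_cvgr _ (cvg_cst 0) c).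
near=> k; rewrite normr_ge0 H//; near: k; exact: nbhs_infty_gt.
Unshelve. all: by end_near. Qed.

(** This is the limit M -> oo of [series_remainder_termB]: every exponent 2r + p is at least 2, so
    each Möbius series converges to 1 / zeta(2r + p). *)
Lemma sum_riesz2_term (R : realType) (p x : R) k :
  0 <= p -> 0 <= x -> (0 < k)%N ->
  \sum_(1 <= r < k) riesz2_term p x r =
  limn (series (remainder_term p x 1)) - limn (series (remainder_term p x k)).
Proof.
move=> p0 x0 k0.
have c1 := cvg_series_remainder_term p0 x0 (ltn0Sn 0).
have ck := cvg_series_remainder_term p0 x0 k0.
apply: oppr_inj; rewrite opprB -sumrN; apply/esym.
apply: (cvg_unique _ (cvgB ck c1)) => //.
(* The range is repeated as a filter so that [r >= 1] is available when the limit is taken term by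
   term. *)
rewrite (_ : _ - _ = fun M => \sum_(1 <= r < k | (1 <= r < k)%N)
    (- x) ^+ r / r`!%:R * series (moebius_term ((2 * r)%:R + p)) M); last first.
  by apply/funext => M; rewrite -big_nat -series_remainder_termB.
rewrite big_nat; apply: cvg_big => [|r /andP[r1 _]]; first exact: add_continuous.
rewrite riesz2_termE opprK.
have s2 : 2 <= (2 * r)%:R + p.
  by rewrite (le_trans (_ : 2 <= (2 * r)%:R))// ?lerDl// ler_nat leq_pmulr.
rewrite /inv_zeta ifF; last by apply/eqP; lra.
by apply: cvgMr; exact: cvg_series_moebius_term.
Qed.

(** The first k terms consist of the term j = 0, equal to [- inv_zeta p], and of V_1 - V_k, where
    V_k tends to 0. *)
Lemma cvg_series_riesz2_term (R : realType) (p x : R) :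
  0 <= p -> 0 <= x ->
  series (riesz2_term p x) @ \oo -->
    limn (series (remainder_term p x 1)) - inv_zeta p.
Proof.
move=> p0 x0.
set F := limn _.
have : F - limn (series (remainder_term p x k)) - inv_zeta p @[k --> \oo] -->
    F - 0 - inv_zeta p.
  apply: cvgB; last exact: cvg_cst.
  by apply: cvgB; [exact: cvg_cst|exact: cvg_lim_series_remainder_term].
rewrite subr0; apply: cvg_trans; apply: near_eq_cvg; near=> k.
have k0 : (0 < k)%N by near: k; exact: nbhs_infty_gt.
rewrite -sum_riesz2_term// seriesEnat /= [RHS]big_ltn// addrC; congr (_ + _).
by rewrite riesz2_termE expr0 fact0 divr1 mul1r muln0 add0r.
Unshelve. all: by end_near. Qed.

(** * The two correction terms and the final identity *)

Lemma T1_termE (R : realType) k (p x : R) n : (0 < k)%N -> 0 < x ->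
  T1_term k p x n = k`!%:R * remainder_term p x k n.
Proof.
move=> k0 x0; case: n => [|n].
  (* Here [X_ x 0] is 0 by the convention on division, outside the scope of [f_sub_gE]; both sides
     vanish because mu(0) = 0. *)
  by rewrite remainder_term0 /T1_term moebius0 !mul0r mulr0.
have X0 : 0 < X_ x n.+1 by rewrite divr_gt0 ?exprn_gt0.
by rewrite /T1_term f_sub_gE// mulrCA.
Qed.

(** Since (-X_N)^r * N^(2r) = (-x)^r, the finite Möbius sums in [lambda_] give the difference of
    partial sums below N, and the [inv_zeta] parts give the Riesz terms. *)
Lemma T2E (R : realType) k N (p x : R) : (0 < k)%N -> (0 < N)%N ->
  T2 k N p x = series (remainder_term p x k) N - series (remainder_term p x 1) N
    + \sum_(1 <= r < k) riesz2_term p x r.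
Proof.
move=> k0 N0; rewrite series_remainder_termB// -big_split /=; apply: eq_bigr => r _.
rewrite riesz2_termE -mulrBr /lambda_ mulrA; congr (_ * _); last first.
  by congr (_ - _); rewrite seriesEnat /= [RHS]big_ltn// moebius_term0 add0r.
have NE : N%:R ^+ 2 != 0 :> R by rewrite expf_neq0// pnatr_eq0 -lt0n.
by rewrite mulrAC exprM -exprMn mulNr divfK.
Qed.

Theorem mainTheorem1 (R : realType) (p x : R) (k N : nat)
  (hp : 1 <= p) (hx : 0 < x) (hk : (2 <= k)%N)
  (hN : N%:Z = Num.ceil (Num.sqrt x)) :
  [/\ cvgn (series (riesz2_term p x)),
      cvgn (fun M => \sum_(N <= n < M) T1_term k p x n) &
      riesz2 p x =
        \sum_(1 <= n < N) (moebius n)%:~R / n%:R `^ p * (1 - expR (- X_ x n))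
        - inv_zeta p + T1 k N p x + T2 k N p x ].
Proof.
have N0 : (0 < N)%N by rewrite -ltz_nat hN ceil_gt0 sqrtr_gt0.
have k0 : (0 < k)%N by exact: leq_trans hk.
have p0 : 0 <= p by lra.
have x0 := ltW hx.
have cR := cvg_series_riesz2_term p0 x0.
pose V := series (remainder_term p x k).
have cT : (fun M => \sum_(N <= n < M) T1_term k p x n) @ \oo -->
    k`!%:R * (limn V - V N).
  have : k`!%:R * (V M - V N) @[M --> \oo] --> k`!%:R * (limn V - V N).
    apply: cvgMr; apply: cvgB; last exact: cvg_cst.
    exact: cvg_series_remainder_term.
  apply: cvg_trans; apply: near_eq_cvg; near=> M.
  have NM : (N <= M)%N by near: M; exact: nbhs_infty_ge.
  rewrite /V sub_series_geq// mulr_sumr; apply: eq_bigr => n _.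
  by rewrite T1_termE.
split; [by apply/cvg_ex; eexists; exact: cR|by apply/cvg_ex; eexists; exact: cT|].
rewrite /riesz2 (cvg_lim _ cR)// /T1 (cvg_lim _ cT)// mulKf ?fact_neq0//.
(* With V_k(N) the partial sum below N, T1 = V_k - V_k(N) and T2 = V_k(N) - V_1(N) + V_1 - V_k. Once
   the leading sum is recognised as V_1(N), everything but V_1 - [inv_zeta p] cancels. *)
rewrite T2E// sum_riesz2_term// /V.
have -> : \sum_(1 <= n < N) (moebius n)%:~R / n%:R `^ p * (1 - expR (- X_ x n))
    = series (remainder_term p x 1) N.
  rewrite seriesEnat /= [RHS]big_ltn// remainder_term0 add0r.
  by apply: eq_bigr => n _; rewrite /remainder_term horner_e_from1// big_geq// addr0.
by ring.
Unshelve. all: by end_near. Qed.
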